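(* Let $k\geq 1$, let $G=F_k$ be the free group of rank $k$, let $m\in\mathbb{Z}$ and let $g\in G$. Then there exists $h\in G$ with $g=h^m$ if and only if for every finite-index normal subgroup $K\trianglelefteq G$ there exists $h_K\in G$ with $gK=h_K^mK$ (i.e. $g$ is an $m$-th power in every finite quotient $G/K$). *)

(* Defs.v *)
From HB Require Import structures.
From mathcomp Require Import all_boot all_order all_algebra.
Set Implicit Arguments. Unset Strict Implicit. Unset Printing Implicit Defensive.

(* A letter is a generator index together with a flag: false = x_i, true = x_i^-1 *)
Definition letter (k : nat) := ('I_k * bool)%type.

Definition flip (k : nat) (x : letter k) : letter k := (x.1, ~~ x.2).

Fixpoint reducedb (k : nat) (s : seq (letter k)) : bool :=
  match s with
  | x :: ((y :: _) as t) => (y != flip x) && reducedb t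
  | _ => true
  end.

Definition push (k : nat) (x : letter k) (s : seq (letter k)) : seq (letter k) :=
  if s is y :: t then (if y == flip x then t else x :: s) else [:: x].

Definition reduce (k : nat) (s : seq (letter k)) : seq (letter k) :=
  foldr (@push k) [::] s.

Lemma reducedb_tail (k : nat) (x : letter k) (s : seq (letter k)) :
  reducedb (x :: s) -> reducedb s.
Proof. by case: s => [|y t] //= /andP []. Qed.

Lemma reducedb_push (k : nat) (x : letter k) (s : seq (letter k)) :
  reducedb s -> reducedb (push x s).
Proof.
case: s => [|y t] //= Hs.
case: eqP => [_|/eqP Hy]; first exact: reducedb_tail Hs.
by rewrite /= Hy Hs.
Qed.

Lemma reducedb_reduce (k : nat) (s : seq (letter k)) : reducedb (reduce s).
Proof. by elim: s => [|x s IH] //=; apply: reducedb_push. Qed.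

Definition FreeGroup (k : nat) := {w : seq (letter k) | reducedb w}.

Definition fg_one (k : nat) : FreeGroup k := exist _ [::] isT.

Definition fg_mul (k : nat) (u v : FreeGroup k) : FreeGroup k :=
  exist _ (reduce (sval u ++ sval v)) (reducedb_reduce _).

Definition fg_inv (k : nat) (u : FreeGroup k) : FreeGroup k :=
  exist _ (reduce (rev (map (@flip k) (sval u)))) (reducedb_reduce _).

Definition fg_pow (k : nat) (g : FreeGroup k) (m : int) : FreeGroup k :=
  match m with
  | Posz n => iter n (fg_mul g) (fg_one k)
  | Negz n => iter n.+1 (fg_mul (fg_inv g)) (fg_one k)
  end.

Definition is_subgroup (k : nat) (K : FreeGroup k -> Prop) : Prop :=
  [/\ K (fg_one k),
      (forall x y, K x -> K y -> K (fg_mul x y)) &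
      (forall x, K x -> K (fg_inv x))].

Definition is_normal (k : nat) (K : FreeGroup k -> Prop) : Prop :=
  forall x y, K y -> K (fg_mul (fg_mul x y) (fg_inv x)).

Definition finite_index (k : nat) (K : FreeGroup k -> Prop) : Prop :=
  exists ts : seq (FreeGroup k),
    forall x, exists2 t, t \in ts & K (fg_mul (fg_inv t) x).

Definition fi_normal_subgroup (k : nat) (K : FreeGroup k -> Prop) : Prop :=
  [/\ is_subgroup K, is_normal K & finite_index K].

(* Main.v *)
Require Import Defs.
From HB Require Import structures.
From mathcomp Require Import all_boot all_order all_algebra all_fingroup.
From Stdlib Require Import Classical.
Set Implicit Arguments. Unset Strict Implicit. Unset Printing Implicit Defensive.

(** Up to conjugation g is a nonempty cyclically reduced word c^d of length L,
    where c is not a proper power and has length n.  Complete the cycle graph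
    reading c to a permutation action of F_k on its n vertices, and count, with
    sign, (1) how many edges of the original cycle a walk uses and (2) how often
    it uses the edge leaving the base vertex.  Both counts, taken modulo N, turn
    the action into one on n * N * N points.  Walking along g from a vertex v
    gives first count L only if the walk follows the cycle at every step, which
    forces v to be the base because c is not a proper power.  If g acts as h^m,
    then h commutes with g and hence preserves the first count of g, so h fixes
    the base.  Comparing second counts yields d = m t mod N, and therefore m
    divides d for a suitable N.  The case m = 0 is included, N being larger
    than d. *)

(** * Reduction of words *)

Section Words.
Variable k : nat.
Implicit Types (a b : letter k) (s t : seq (letter k)).

Lemma flipK : involutive (@flip k).
Proof. by case=> i b; rewrite /flip /= negbK. Qed.

Definition nocancel a b := b != flip a.

Lemma reducedb_cons a s : reducedb (a :: s) = path nocancel a s.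
Proof. by elim: s a => [|b s IH] a //=; rewrite -IH. Qed.

Lemma reduce_id s : reducedb s -> reduce s = s.
Proof.
elim: s => [|a s IH] // Hs; rewrite /= -/(reduce s) (IH (reducedb_tail Hs)).
by case: s Hs {IH} => [|b s] //= /andP[/negPf->].
Qed.

(** If [s] starts with [a], the inner push deletes that letter; reducedness keeps [flip a] from
    being next, so the outer push restores it. *)
Lemma pushK a s : reducedb s -> push a (push (flip a) s) = s.
Proof.
case: s => [|b s] Hs /=; first by rewrite eqxx.
rewrite flipK; case: eqP Hs => [->|_] Hs; last by rewrite /= eqxx.
by case: s Hs => [|c s] //= /andP[/negPf->].
Qed.

(** By [pushK] a letter and its inverse act on reduced words as inverse maps, so cancellation inside
    [s] does not change its action on [t]. Associativity of the product rests on this. *)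
Lemma foldr_reduce s t : reducedb t -> foldr (@push k) t (reduce s) = foldr (@push k) t s.
Proof.
move=> Ht; have red r : reducedb (foldr (@push k) t r).
  by elim: r => //= a r IH; apply: reducedb_push.
have fpush a r : foldr (@push k) t (push a r) = push a (foldr (@push k) t r).
  case: r => [|b r] //=; case: eqP => [->|] //.
  by rewrite pushK.
by elim: s => [|a s IH] //=; rewrite -/(reduce s) fpush IH.
Qed.

Lemma reduce_catl s t : reduce (reduce s ++ t) = reduce (s ++ t).
Proof. by rewrite /reduce !foldr_cat foldr_reduce ?reducedb_reduce. Qed.

Lemma reduce_catr s t : reduce (s ++ reduce t) = reduce (s ++ t).
Proof.
by rewrite {1 3}/reduce !foldr_cat -!/(reduce _) (reduce_id (reducedb_reduce t)).
Qed.


Definition word_inv s := rev (map (@flip k) s).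
Lemma word_inv_cons a s : word_inv (a :: s) = rcons (word_inv s) (flip a).
Proof. exact: rev_cons. Qed.

Lemma word_invK : involutive word_inv.
Proof. by move=> s; rewrite /word_inv map_rev revK mapK //; exact: flipK. Qed.

Lemma reduce_invr s : reduce (s ++ word_inv s) = [::].
Proof.
elim: s => //= a s IH; rewrite word_inv_cons -rcons_cat -cats1 -/(reduce _).
by rewrite -reduce_catl IH /= eqxx.
Qed.

Lemma reduce_invl s : reduce (word_inv s ++ s) = [::].
Proof. by rewrite -{2}[s]word_invK reduce_invr. Qed.

End Words.

(** * The group structure on reduced words *)

HB.instance Definition _ k := Choice.on (FreeGroup k).

Section FreeGroupIsGroup.
Variable k : nat.

Lemma fg_mulA : associative (@fg_mul k).
Proof.
move=> x y z; apply: val_inj; rewrite /=.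
by rewrite reduce_catl reduce_catr catA.
Qed.

Lemma fg_mul1 : left_id (fg_one k) (@fg_mul k).
Proof. by move=> [x Hx]; apply: val_inj; rewrite /= reduce_id. Qed.

Lemma fg_mulr1 : right_id (fg_one k) (@fg_mul k).
Proof. by move=> [x Hx]; apply: val_inj; rewrite /= cats0 reduce_id. Qed.

Lemma fg_mulV : left_inverse (fg_one k) (@fg_inv k) (@fg_mul k).
Proof. by move=> [x Hx]; apply: val_inj; rewrite /= reduce_catl reduce_invl. Qed.

Lemma fg_mulrV : right_inverse (fg_one k) (@fg_inv k) (@fg_mul k).
Proof. by move=> [x Hx]; apply: val_inj; rewrite /= reduce_catr reduce_invr. Qed.

End FreeGroupIsGroup.

HB.instance Definition _ k := isGroup.Build (FreeGroup k)
  (@fg_mulA k) (@fg_mul1 k) (@fg_mulr1 k) (@fg_mulV k) (@fg_mulrV k).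

Local Open Scope group_scope.

(** * Homomorphisms to finite groups and their kernels *)

Section Evaluation.
Variable k : nat.

Lemma fg_pow_nat (h : FreeGroup k) n : fg_pow h (Posz n) = h ^+ n.
Proof. exact: iter_mulg_1. Qed.

Lemma fg_pow_negz (h : FreeGroup k) n : fg_pow h (Negz n) = h^-1 ^+ n.+1.
Proof. exact: iter_mulg_1. Qed.

Definition of_word (s : seq (letter k)) : FreeGroup k :=
  exist _ (reduce s) (reducedb_reduce s).

Lemma of_word_cat s t : of_word (s ++ t) = of_word s * of_word t.
Proof. by apply: val_inj; rewrite /= reduce_catl reduce_catr. Qed.

Lemma of_word_nil : of_word [::] = 1.
Proof. exact: val_inj. Qed.

Lemma of_word_inv s : of_word (word_inv s) = (of_word s)^-1.
Proof.
apply/eqP; rewrite -mulg_eq1 -of_word_cat; apply/eqP/val_inj.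
by rewrite /= reduce_invl.
Qed.

Lemma of_word_flatten s n : of_word (flatten (nseq n s)) = of_word s ^+ n.
Proof. by elim: n => [|n IH] /=; rewrite ?of_word_nil // of_word_cat IH expgS. Qed.

Lemma of_word_val (x : FreeGroup k) : of_word (sval x) = x.
Proof. by apply: val_inj; rewrite /= reduce_id // (valP x). Qed.

Variables (gT : finGroupType) (tau : letter k -> gT).
Hypothesis tauV : forall a, tau (flip a) = (tau a)^-1.

Definition eval (x : FreeGroup k) : gT := \prod_(a <- sval x) tau a.

Lemma prod_push a s :
  \prod_(b <- push a s) tau b = tau a * \prod_(b <- s) tau b.
Proof.
case: s => [|b s] /=; first by rewrite big_cons.
by case: eqP => [->|_]; rewrite !big_cons // tauV mulKVg.
Qed.

Lemma eval_of_word s : eval (of_word s) = \prod_(a <- s) tau a.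
Proof.
rewrite /eval /= /reduce.
by elim: s => [|a s IH] /=; rewrite ?big_nil // prod_push big_cons IH.
Qed.

Lemma evalM : {morph eval : x y / x * y}.
Proof.
move=> x y; rewrite -{1}[x]of_word_val -{1}[y]of_word_val -of_word_cat.
by rewrite eval_of_word big_cat.
Qed.

Lemma eval1 : eval 1 = 1.
Proof. by rewrite /eval big_nil. Qed.

Lemma evalV x : eval x^-1 = (eval x)^-1.
Proof. by apply: (mulIg (eval x)); rewrite -evalM !mulVg eval1. Qed.

Lemma evalX x n : eval (x ^+ n) = eval x ^+ n.
Proof. by elim: n => [|n IH]; rewrite ?eval1 // !expgS evalM IH. Qed.

(** Finite index asks for a list of coset representatives: one preimage is kept for each attained
    value, and excluded middle decides which values are attained. *)
Lemma finite_representatives (s : seq gT) :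
  exists ts : seq (FreeGroup k),
    forall x, eval x \in s -> exists2 t, t \in ts & eval t = eval x.
Proof.
elim: s => [|y s [ts IH]]; first by exists [::].
have [[z zy]|nz] := classic (exists z, eval z = y).
  exists (z :: ts) => x; rewrite inE => /predU1P[xy|/IH[t tts tx]].
    by exists z; rewrite ?mem_head // zy.
  by exists t => //; rewrite inE tts orbT.
exists ts => x; rewrite inE => /predU1P[xy|/IH //].
by case: nz; exists x.
Qed.

Lemma ker_eval_fi_normal : fi_normal_subgroup (fun x => eval x = 1).
Proof.
split.
- split; first exact: eval1.
  + by move=> x y Kx Ky; rewrite [LHS]evalM Kx Ky mulg1.
  + by move=> x Kx; rewrite [LHS]evalV Kx invg1.
- move=> x y Ky; rewrite -[fg_mul _ _]/(x * y * x^-1).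
  by rewrite !evalM evalV Ky mulg1 mulgV.
- have [ts tsP] := finite_representatives (enum gT).
  exists ts => x; have [|t tts tx] := tsP x; first by rewrite mem_enum.
  by exists t => //; rewrite -[fg_mul _ _]/(t^-1 * x) evalM evalV tx mulVg.
Qed.

End Evaluation.

(** * Cyclic reduction and periods of cyclic words *)

(** Induction on length: if the outer letters of a reduced word are mutually inverse, the word is
    the conjugate of its middle by the last letter. *)
Lemma cyclic_conjugate k (x : FreeGroup k) :
  exists s u, path.cycle (@nocancel k) s /\ x = of_word s ^ u.
Proof.
rewrite -[x]of_word_val; case: x => s /=.
have [n] := ubnP (size s); elim: n s => // n IH [|a s] sn.
  by exists [::], 1; rewrite conjg1.
case/lastP: s sn => [|s b] sn red.
  by exists [:: a], 1; rewrite conjg1 /= andbT /nocancel; case: a {sn red} => i [] /=;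
    rewrite /flip xpair_eqE andbF.
have [ab|nab] := eqVneq a (flip b); last first.
  exists (a :: rcons s b), 1; rewrite conjg1 /=; split=> //.
  by rewrite rcons_path last_rcons -reducedb_cons red.
have reds : reducedb s.
  have := red; rewrite reducedb_cons rcons_path => /andP[+ _].
  by rewrite -reducedb_cons => /reducedb_tail.
have [] := IH s _ reds; first by move: sn; rewrite /= size_rcons; exact: ltnW.
move=> c [u [cc Es]]; exists c, (u * of_word [:: b]); split=> //.
rewrite conjgM -Es -cat1s -cats1 !of_word_cat conjgE -[in RHS]of_word_inv.
by rewrite /word_inv /= ab.
Qed.
Local Notation osucc := (@ordS _).

Lemma val_iter_ordS n j (i : 'I_n.+1) :
  iter j osucc i = ((i + j) %% n.+1)%N :> nat.
Proof.
elim: j => [|j IH]; first by rewrite addn0 modn_small.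
by rewrite iterS /= IH -addn1 modnDml addn1 addnS.
Qed.

(** Here [n.+1] is the least period of the cyclic word, [f] reads one period and [d] counts the
    periods. The last clause says that this period is not a proper power: no nontrivial rotation
    fixes it. *)
Lemma periodic_word (T : eqType) (e : rel T) (w : seq T) :
  path.cycle e w -> w != [::] ->
  exists n (f : 'I_n.+1 -> T) d,
    [/\ (0 < d)%N, w = map f (traject osucc ord0 (d * n.+1)),
        forall i, e (f i) (f (ordS i)) &
        forall v, (forall j, (j < n.+1)%N ->
          f (iter j osucc v) = f (iter j osucc ord0)) -> v = ord0].
Proof.
case: w => // x0 p cyc _; set w := x0 :: p; pose L := size w.
have L0 : (0 < L)%N by [].
pose g j := nth x0 w (j %% L).
have gL j q : g (j + q * L)%N = g j by rewrite /g addnC modnMDl.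
have eg j : e (g j) (g j.+1).
  have jL : (j %% L < L)%N by rewrite ltn_mod.
  have /(pathP x0)/(_ (j %% L)%N) := cyc; rewrite size_rcons => /(_ jL).
  rewrite -[nth x0 (x0 :: _) _]/(nth x0 (rcons w x0) _) nth_rcons jL -/(g j).
  rewrite nth_rcons; have := jL; rewrite ltnS leq_eqVlt => /predU1P[jE|jp].
    suff -> : g j.+1 = x0 by rewrite jE ltnn eqxx.
    by rewrite /g -addn1 -modnDml jE addn1 modnn.
  suff -> : g j.+1 = nth x0 p (j %% L) by rewrite jp.
  by rewrite /g -addn1 -modnDml addn1 modn_small.
(* Positive periods of [g], the infinite repetition of [w]; as L is a period, comparing L positions
   is enough. *)
pose P v := (0 < v)%N && [forall j : 'I_L, g (v + j)%N == g j].
have Pg v : P v -> forall j, g (v + j)%N = g j.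
  case/andP=> _ /forallP Pv j; rewrite (divn_eq j L) addnC -addnA addnC gL.
  rewrite [(_ * L + _)%N]addnC gL addnC.
  by apply/eqP/(Pv (Ordinal (_ : j %% L < L)%N)); rewrite ltn_mod.
have exP : exists v, P v.
  by exists L; apply/andP; split=> //; apply/forallP => j; rewrite /g modnDl.
case: (ex_minnP exP) => -[|n] // Pn minn.
have gn j q : g (j + q * n.+1)%N = g j.
  by elim: q => [|q IH]; rewrite ?addn0 // mulSn addnCA Pg.
(* A nonzero remainder of L would be a period smaller than the least one. *)
have /dvdnP[d Ld] : (n.+1 %| L)%N.
  rewrite /dvdn -leqn0 leqNgt; apply/negP => r0.
  have /minn : P (L %% n.+1)%N.
    apply/andP; split=> //; apply/forallP => j; apply/eqP.
    rewrite -(gn _ (L %/ n.+1)) addnAC [(_ %% _ + _)%N]addnC -divn_eq addnC.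
    by rewrite -[L in (j + L)%N]mul1n gL.
  by rewrite leqNgt ltn_mod.
have gmod j : g (j %% n.+1)%N = g j.
  by rewrite [in RHS](divn_eq j n.+1) addnC gn.
exists n, (fun i => g i), d; split.
- by case: d Ld L0 => // ->.
- apply: (@eq_from_nth _ x0); first by rewrite size_map size_traject.
  move=> j jL; rewrite (nth_map ord0) ?size_traject -?Ld // nth_traject -?Ld //.
  by rewrite val_iter_ordS gmod add0n /g modn_small.
- by move=> i; rewrite /= gmod; apply: eg.
- move=> v Hv; apply/eqP/contraT; rewrite -val_eqE /= -lt0n => v0.
  have /minn : P v.
    rewrite /P v0; apply/forallP => j; apply/eqP; rewrite -gmod -modnDmr.
    have := Hv (j %% n.+1)%N; rewrite ltn_mod => /(_ isT).
    by rewrite !val_iter_ordS add0n modn_mod [RHS]gmod.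
  by rewrite leqNgt ltn_ord.
Qed.

(** * Completion of the cycle graph to a permutation action *)

(** Points of [D] are added one at a time: a transposition corrects the value at the new point, and
    injectivity of [q] keeps it away from the earlier values. *)
Lemma perm_extend (T : finType) (D : {set T}) (q : T -> T) :
  {in D &, injective q} -> exists s : {perm T}, {in D, s =1 q}.
Proof.
move: {2}#|D| (leqnn #|D|) => n; elim: n D => [|n IH] D.
  by rewrite leqn0 cards_eq0 => /eqP-> _; exists 1 => x; rewrite inE.
have [->|[a aD]] := set_0Vmem D; first by move=> *; exists 1 => x; rewrite inE.
rewrite (cardsD1 a) aD ltnS => /IH{IH} IH inj.
have [|s sq] := IH.
  by move=> x y /setD1P[_ xD] /setD1P[_ yD]; apply: inj.
exists (s * tperm (s a) (q a)) => x xD; rewrite permM.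
have [->|xa] := eqVneq x a; first by rewrite tpermL.
have xDa : x \in D :\ a by rewrite !inE xa.
rewrite -(sq x xDa) tpermD //; first by rewrite (inj_eq perm_inj) eq_sym.
by rewrite sq //; apply: contra_neq xa => /inj ->.
Qed.

Section CycleGraph.
Variables (k n : nat) (f : 'I_n.+1 -> letter k).
Hypothesis fS : forall i, nocancel (f i) (f (ordS i)).

Lemma cycle_graph_completion : exists sigma : letter k -> {perm 'I_n.+1},
  (forall a, sigma (flip a) = (sigma a)^-1) /\ (forall i, sigma (f i) i = ordS i).
Proof.
have ext (x : 'I_k) : exists s : {perm 'I_n.+1}, forall i,
    (f i = (x, false) -> s i = ordS i) /\ (f i = (x, true) -> s (ordS i) = i).
  (* On [D] the move of the generator [x] is forced: forward along an edge reading it, or back along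
     a preceding edge reading its inverse. The absence of cancellation makes these rules consistent
     and jointly injective. *)
  pose q i := if f i == (x, false) then ordS i else ord_pred i.
  pose D := [set i | (f i == (x, false)) || (f (ord_pred i) == (x, true))].
  have fwd_bwd i : f i = (x, false) -> f (ordS i) = (x, true) -> False.
    by move=> fi fSi; have := fS i; rewrite /nocancel fi fSi eqxx.
  have bwd_fwd i : f i = (x, true) -> f (ordS i) = (x, false) -> False.
    by move=> fi fSi; have := fS i; rewrite /nocancel fi fSi eqxx.
  have injq : {in D &, injective q}.
    move=> i j; rewrite !inE /q.
    case: eqP => [fi _|_ /eqP fi]; case: eqP => [fj _|_ /eqP fj] /=.
    - exact: ordS_inj.
    - by move=> E; case: (fwd_bwd i fi); rewrite E.
    - by move=> E; case: (fwd_bwd j fj); rewrite -E.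
    - exact: ord_pred_inj.
  have [s sq] := perm_extend injq; exists s => i; split=> fi.
    by rewrite sq ?inE ?fi ?eqxx // /q fi eqxx.
  rewrite sq ?inE ?ordSK ?fi ?eqxx ?orbT // /q ordSK.
  by case: eqP => // /(bwd_fwd _ fi).
have [p pP] := fin_all_exists ext.
exists (fun a => if a.2 then (p a.1)^-1 else p a.1); split.
  by case=> x [] /=; rewrite ?invgK.
move=> i; case E : (f i) => [x []] /=; last by case: (pP x i) => ->.
by apply: (canLR (permK _)); case: (pP x i) => _ ->.
Qed.

(** * Walks on the completed graph and their signed edge counts *)

Variable sigma : letter k -> {perm 'I_n.+1}.
Hypothesis sigmaV : forall a, sigma (flip a) = (sigma a)^-1.
Hypothesis sigma_f : forall i, sigma (f i) i = ordS i.

Local Open Scope ring_scope.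
Import GRing.Theory Num.Theory Order.TTheory.

(* The edge from [i] to [ordS i] of the cycle carries [chi i], the edges added by
   the completion carry 0, and edges walked backwards count negatively. *)
Definition weight (chi : 'I_n.+1 -> int) (a : letter k) (i : 'I_n.+1) : int :=
  chi i *+ (f i == a) - chi (sigma a i) *+ (f (sigma a i) == flip a).

Lemma weightV chi a i : weight chi (flip a) (sigma a i) = - weight chi a i.
Proof. by rewrite /weight sigmaV permK flipK opprB. Qed.

Lemma weight_f chi i : weight chi (f i) i = chi i.
Proof.
by rewrite /weight sigma_f eqxx (negPf (fS i)) subr0.
Qed.

Fixpoint run (s : seq (letter k)) i :=
  if s is a :: t then run t (sigma a i) else i.

Fixpoint label chi (s : seq (letter k)) i : int :=
  if s is a :: t then weight chi a i + label chi t (sigma a i) else 0.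

Lemma run_cycle i L : run (map f (traject osucc i L)) i = iter L osucc i.
Proof. by elim: L i => //= L IH i; rewrite sigma_f IH -iterSr. Qed.

Lemma label_cycle chi i L :
  label chi (map f (traject osucc i L)) i = \sum_(j <- traject osucc i L) chi j.
Proof.
elim: L i => [|L IH] i /=; first by rewrite big_nil.
by rewrite weight_f sigma_f IH big_cons.
Qed.

Lemma weight1_le a i : weight (fun=> 1) a i <= 1 ?= iff (f i == a).
Proof.
rewrite /weight; case: eqP => [<-|_] /=; first by rewrite sigma_f (negPf (fS i)).
by case: eqP.
Qed.

Lemma label1_le s i : `|label (fun=> 1) s i| <= (size s)%:R.
Proof.
elim: s i => [|a s IH] i //=; apply: le_trans (ler_normD _ _) _.
rewrite -[in leRHS]natr1 addrC lerD // /weight.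
by case: eqP; case: eqP.
Qed.

(** Each of the L steps counts at most 1, so a total of L forces every step to run forward along the
    cycle. *)
Lemma label1_eq L i v :
  label (fun=> 1) (map f (traject osucc i L)) v = L%:R ->
  forall j, (j < L)%N -> f (iter j osucc v) = f (iter j osucc i).
Proof.
elim: L i v => [|L IH] i v //= lab.
have := label1_le (map f (traject osucc (ordS i) L)) (sigma (f i) v).
move/(le_trans (ler_norm _)); rewrite size_map size_traject => labL.
have [w1 wE] := weight1_le (f i) v.
have /eqP fv : f v == f i.
  rewrite -wE; apply/eqP/le_anti; rewrite w1 /=.
  by rewrite -(lerD2r L%:R) nat1r -lab lerD2l.
case=> [|j] jL //; rewrite !iterSr; apply: IH => //.
move: lab; rewrite -fv weight_f sigma_f -nat1r => /addrI.
exact.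
Qed.

(** * The finite cover recording two counts *)

Section Cover.
Variables (N : nat) (chi1 chi2 : 'I_n.+1 -> int).

(** A skew product over the action [sigma]: the added coordinates accumulate the two weights. By
    [weightV], inverse letters undo each other. *)
Definition cover_step a (y : 'I_n.+1 * 'Z_N * 'Z_N) :=
  (sigma a y.1.1, y.1.2 + (weight chi1 a y.1.1)%:~R,
   y.2 + (weight chi2 a y.1.1)%:~R).

Lemma cover_stepK a : cancel (cover_step a) (cover_step (flip a)).
Proof.
case=> [[i x] y]; rewrite /cover_step /= !weightV sigmaV permK.
by rewrite !mulrNz !addrK.
Qed.

Definition cover_perm a : {perm 'I_n.+1 * 'Z_N * 'Z_N} :=
  perm (can_inj (cover_stepK a)).

Lemma cover_permV a : cover_perm (flip a) = (cover_perm a)^-1%g.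
Proof.
apply/eqP; rewrite -mulg_eq1; apply/eqP/permP => y.
by rewrite permM perm1 !permE -{1}[a]flipK cover_stepK.
Qed.

Lemma cover_wordE s y :
  (\prod_(a <- s) cover_perm a)%g y =
  (run s y.1.1, y.1.2 + (label chi1 s y.1.1)%:~R,
   y.2 + (label chi2 s y.1.1)%:~R).
Proof.
elim: s y => [|a s IH] y.
  by case: y => -[i x] y; rewrite big_nil perm1 /= !addr0.
by rewrite big_cons permM permE IH /cover_step /= !intrD !addrA.
Qed.

End Cover.

Lemma sum_period d (F : 'I_n.+1 -> int) :
  \sum_(j <- traject osucc ord0 (d * n.+1)) F j = (\sum_j F j) *+ d.
Proof.
have cyc : traject osucc ord0 n.+1 = enum 'I_n.+1.
  apply: (@eq_from_nth _ ord0); first by rewrite size_traject size_enum_ord.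
  move=> j; rewrite size_traject => jn; apply: ord_inj; rewrite nth_traject //.
  by rewrite val_iter_ordS /= nth_enum_ord // modn_small.
elim: d => [|d IH]; first by rewrite big_nil.
rewrite mulSn trajectD big_cat mulrS -IH cyc big_enum; congr (_ + \sum_(j <- traject _ _ _) _).
by apply: ord_inj; rewrite val_iter_ordS modnn.
Qed.

Lemma root_in_cover_quotients d m : (0 < d)%N ->
  (forall v, (forall j, (j < n.+1)%N ->
     f (iter j osucc v) = f (iter j osucc ord0)) -> v = ord0) ->
  (forall (gT : finGroupType) (tau : letter k -> gT),
     (forall a, tau (flip a) = (tau a)^-1%g) ->
     exists s, (\prod_(a <- map f (traject osucc ord0 (d * n.+1))) tau a)%g =
               ((\prod_(a <- s) tau a) ^+ m)%g) ->
  (m %| d)%N.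
Proof.
move=> d0 prim root; set L := (d * n.+1)%N; set w := map f _ in root.
have L0 : (0 < L)%N by rewrite muln_gt0 d0.
(* The first factor makes [m] divide [N] unless [m = 0]; the second makes counts
   of absolute value at most [L] distinguishable modulo [N]. *)
pose N := (maxn 1 m * (2 * L).+1)%N.
have NL : (2 * L < N)%N by rewrite /N leq_pmull // leq_max.
(* Needed because ['Z_N] is the ring of integers modulo N only for N > 1. *)
have N1 : (1 < N)%N by apply: leq_trans NL; rewrite ltnS muln_gt0.
have natN (a b : nat) : (a%:R == b%:R :> 'Z_N) = (a == b %[mod N])%N.
  by rewrite -val_eqE /= !val_Zp_nat.
(* Along [w] the constant weight 1 gives the length L, while [delta] gives the number d of turns. *)
pose delta (i : 'I_n.+1) : int := (i == ord0)%:R.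
have [s Es] := root _ _ (cover_permV N (fun=> 1) delta).
set eta := (\prod_(a <- s) _)%g in Es.
have etaE y : eta y = (run s y.1.1, y.1.2 + (label (fun=> 1) s y.1.1)%:~R,
    y.2 + (label delta s y.1.1)%:~R) by exact: cover_wordE.
have run_w : run w ord0 = ord0.
  by rewrite run_cycle //; apply: ord_inj; rewrite val_iter_ordS modnMl.
have label1_w : label (fun=> 1) w ord0 = L%:R.
  by rewrite label_cycle big_const_seq count_predT size_traject iter_addr_0.
have label2_w : label delta w ord0 = d%:R.
  rewrite label_cycle sum_period (bigD1 ord0) //= big1 ?addr0 // => i.
  by rewrite /delta => /negPf->.
(* [eta] commutes with the action of [w], so [w] has the same first count from
   [run s ord0] as from [ord0], namely its full length. *)
have run0 : run s ord0 = ord0.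
  have comm x y : (eta ^+ m * eta)%g (ord0, x, y) = (eta * eta ^+ m)%g (ord0, x, y).
    by rewrite -expgSr expgS.
  have := comm 0 0; rewrite -Es !permM !etaE !cover_wordE /= run_w label1_w.
  rewrite !add0r => /eqP.
  rewrite xpair_eqE => /andP[/andP[_ /eqP]] + _; rewrite addrC => /addrI E.
  apply: prim => j jn; apply: (label1_eq (L := L)); last first.
    by apply: leq_trans jn _; rewrite leq_pmull.
  (* Since v lies between -L and L, the difference L - v lies in [0, 2L], below N, so the congruence
     [E] is an equality of integers. *)
  set v := label _ _ _ in E *.
  have : `|v| <= L%:R.
    by apply: le_trans (label1_le _ _) _; rewrite size_map size_traject.
  rewrite ler_norml => /andP[vge vle].
  have [t Et] : exists t : nat, L%:R - v = t%:R.
    by exists `|L%:R - v|%N; rewrite [RHS]natz gez0_abs // subr_ge0.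
  have tN : (t < N)%N.
    apply: leq_ltn_trans NL; rewrite -(ler_nat int) -Et mul2n -addnn natrD.
    by rewrite lerD2l lerNl.
  have : t%:R == 0%:R :> 'Z_N.
    by rewrite -[t%:R]mulrz_nat -Et intrB E subrr.
  rewrite natN mod0n modn_small // => /eqP t0.
  by apply/eqP; rewrite eq_sym -subr_eq0 Et t0.
(* As [eta] fixes the base vertex, each application there adds the same two counts. *)
have etaX q x y : (eta ^+ q)%g (ord0, x, y) =
    (ord0, x + (label (fun=> 1) s ord0)%:~R *+ q, y + (label delta s ord0)%:~R *+ q).
  elim: q => [|q IH]; first by rewrite perm1 !addr0.
  by rewrite expgSr permM IH etaE /= run0 !mulrSr !addrA.
have : (\prod_(a <- w) cover_perm N (fun=> 1%R) delta a)%g (ord0, 0, 0) =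
    (eta ^+ m)%g (ord0, 0, 0) by rewrite Es.
rewrite cover_wordE etaX /= label2_w !add0r => /eqP.
rewrite xpair_eqE => /andP[_]; set z := (label delta s ord0)%:~R.
rewrite mulrz_nat -[z]natr_Zp -mulrnA natN => /eqP dz.
have [m0|m0] := posnP m.
  move: dz; rewrite m0 muln0 mod0n modn_small => [d00|].
    by rewrite d00 in d0.
  by apply: leq_ltn_trans NL; rewrite mulnCA leq_pmulr.
(* For positive m, m divides N, so the congruence of d with a multiple of m modulo N also holds
   modulo m. *)
have mN : (m %| N)%N by rewrite dvdn_mulr // (maxn_idPr _).
by rewrite /dvdn -(modn_dvdm _ mN) dz modn_dvdm // modnMl.
Qed.

End CycleGraph.

(** * From finite quotients to roots in the free group *)

Lemma of_word_period k n (f : 'I_n.+1 -> letter k) d :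
  of_word (map f (traject osucc ord0 (d * n.+1))) =
  of_word (map f (traject osucc ord0 n.+1)) ^+ d.
Proof.
elim: d => [|d IH]; first by rewrite of_word_nil.
rewrite mulSn trajectD map_cat of_word_cat expgS -IH.
congr (_ * of_word (map f (traject _ _ _))).
by apply: ord_inj; rewrite val_iter_ordS modnn.
Qed.

(** Taking for [K] the kernels of evaluations into finite groups supplies the roots required by
    [root_in_cover_quotients]; hence m divides the exponent d of the cyclic word. *)
Lemma root_of_root_in_finite_quotients k (g : FreeGroup k) m :
  (forall K, fi_normal_subgroup K -> exists h, K ((h ^+ m)^-1 * g)) ->
  exists h, g = h ^+ m.
Proof.
have [s [u [cyc ->]]] := cyclic_conjugate g => root.
have [s0|s_neq0] := eqVneq s [::].
  by exists 1; rewrite s0 of_word_nil conj1g expg1n.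
have [n [f [d [d_gt0 Ds fS prim]]]] := periodic_word cyc s_neq0.
have [sigma [sigmaV sigma_f]] := cycle_graph_completion fS.
have /dvdnP[e De] : (m %| d)%N.
  apply: (root_in_cover_quotients fS sigmaV sigma_f d_gt0 prim) => gT tau tauV.
  have [h] := root _ (ker_eval_fi_normal tauV).
  rewrite evalM // evalV // => /eqP; rewrite mulg_eq1 eqg_inv => /eqP Eh.
  (* Conjugating back by [u] turns a root of g in the quotient into a root of its cyclically reduced
     form. *)
  exists (sval (h ^ u^-1)); rewrite -Ds -eval_of_word // -/(eval _ _).
  by rewrite -evalX // -conjXg !conjgE !evalM // Eh !evalM // !evalV // invgK
    !mulgA mulgV mul1g mulgK.
exists ((of_word (map f (traject osucc ord0 n.+1)) ^+ e) ^ u).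
by rewrite Ds of_word_period De expgnA conjXg.
Qed.

Theorem mainTheorem1 (k : nat) (hk : (0 < k)%N) (m : int) (g : FreeGroup k) :
  (exists h : FreeGroup k, g = fg_pow h m) <->
  (forall K : FreeGroup k -> Prop, fi_normal_subgroup K ->
     exists hK : FreeGroup k, K (fg_mul (fg_inv (fg_pow hK m)) g)).
Proof.
split=> [[h ->] K [[K1 _ _] _ _]|root]; first by exists h; rewrite fg_mulV.
case: m root => n root.
  have [|h ->] := @root_of_root_in_finite_quotients k g n; last first.
    by exists h; rewrite fg_pow_nat.
  by move=> K /root[h]; rewrite fg_pow_nat; exists h.
(* [Negz n] stands for -(n+1); replacing roots by their inverses reduces to the exponent n+1. *)
have [|h ->] := @root_of_root_in_finite_quotients k g n.+1; last first.
  by exists h^-1; rewrite fg_pow_negz invgK.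
by move=> K /root[h]; rewrite fg_pow_negz; exists h^-1.
Qed.
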